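(* Let $(S,\cdot,\ast)$ be a regular $\star$-semigroup. Define a binary operation $+$ on $S$ by $a+b=aa^{\ast}b$ for all $a,b\in S$. Then the map $r_S$ associated to $(S,+,\cdot,\ast)$ is a solution of the Yang-Baxter equation.
   Context: A regular $\star$-semigroup is a triple $(S,\cdot,\ast)$ where $(S,\cdot)$ is a semigroup on a non-empty set and $\ast:S\to S$, $x\mapsto x^\ast$, satisfies $xx^\ast x=x$, $(x^\ast)^\ast=x$, $(xy)^\ast=y^\ast x^\ast$ for all $x,y\in S$. For a set $S$ with binary operations $+,\cdot$ ($+$ not necessarily associative) and a unary operation $\ast$, the map associated to $(S,+,\cdot,\ast)$ is $r_S:S\times S\to S\times S$, $r_S(a,b)=(a(a^{\ast}+b),\,(a^{\ast}+b)^{\ast}b)$. A map $r:S\times S\to S\times S$ is a (set-theoretic) solution of the Yang-Baxter equation if $(r\times \mathrm{id}_S)(\mathrm{id}_S\times r)(r\times \mathrm{id}_S)=(\mathrm{id}_S\times r)(r\times \mathrm{id}_S)(\mathrm{id}_S\times r)$ as maps $S^3\to S^3$. *)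

(* Defs.v *)
From mathcomp Require Import ssreflect ssrfun ssrbool.

Set Implicit Arguments.
Unset Strict Implicit.
Unset Printing Implicit Defensive.

(* The carrier is a bare Type: MathComp's semigroupType would add a choiceType
   structure, hence decidable equality, and its starMonoidType a unit. *)
Record regular_star_semigroup (S : Type) (mul : S -> S -> S) (star : S -> S) :
    Prop := RegularStarSemigroup {
  rss_nonempty : inhabited S;
  rss_mulA : associative mul;
  rss_regular : forall x, mul (mul x (star x)) x = x;
  rss_starK : forall x, star (star x) = x;
  rss_starM : forall x y, star (mul x y) = mul (star y) (star x)
}.

Definition associated_map (S : Type) (add mul : S -> S -> S) (star : S -> S)
    (p : S * S) : S * S :=
  let: (a, b) := p in
  (mul a (add (star a) b), mul (star (add (star a) b)) b).

(* r x id and id x r, with S^3 encoded as (S * S) * S. *)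
Definition map_times_id (S : Type) (r : S * S -> S * S) (t : S * S * S) :
    S * S * S :=
  let: (x, y, z) := t in let: (x', y') := r (x, y) in (x', y', z).

Definition id_times_map (S : Type) (r : S * S -> S * S) (t : S * S * S) :
    S * S * S :=
  let: (x, y, z) := t in let: (y', z') := r (y, z) in (x, y', z').

Definition yang_baxter_solution (S : Type) (r : S * S -> S * S) : Prop :=
  map_times_id r \o id_times_map r \o map_times_id r
    =1 id_times_map r \o map_times_id r \o id_times_map r.

(* Main.v *)
(* Here [a^* + b = a^* a b], so the associated map is
   [r (a, b) = (ab, (ab)^* (ab))], whose second entry is a projection. Both
   sides of the braid relation then send [(a, b, c)] to [(abc, u, u)] with
   [u = (abc)^* (abc)]. *)

Require Import Defs.
From mathcomp Require Import ssreflect ssrfun ssrbool.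

Theorem proposition4p6 (S : Type) (mul : S -> S -> S) (star : S -> S)
    (hS : regular_star_semigroup mul star) (add : S -> S -> S)
    (hadd : forall a b : S, add a b = mul (mul a (star a)) b) :
  yang_baxter_solution (associated_map add mul star).
Proof.
case: hS => _ mulA reg starK starM.
pose proj x := mul (star x) x.
have mul_proj x : mul x (proj x) = x by rewrite /proj mulA reg.
(* [proj x] is fixed by [star] and, by [mul_proj], idempotent. *)
have projK x : proj (proj x) = proj x.
  by rewrite {1}/proj {1}/proj starM starK -/(proj x) {1}/proj -mulA mul_proj.
have rE a b : associated_map add mul star (a, b) = (mul a b, proj (mul a b)).
  rewrite /associated_map hadd starK; congr pair.
    by rewrite !mulA reg.
  by rewrite /proj !starM starK !mulA.
have proj_projl x c : proj (mul (proj x) c) = proj (mul x c).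
  (* Regrouped to isolate [proj (proj x)], which [projK] collapses. *)
  have -> : proj (mul (proj x) c) = mul (mul (star c) (proj (proj x))) c.
    by rewrite /proj !starM !mulA.
  by rewrite projK /proj !starM !mulA.
(* [proj (mul a x)] ends in the factor [x], which absorbs [proj x]. *)
have proj_mulr a x : mul (proj (mul a x)) (proj x) = proj (mul a x).
  by rewrite {1}/proj -!mulA mul_proj.
move=> [[a b] c]; rewrite /comp /map_times_id /id_times_map !rE.
(* Up to [proj_projl] the left composite is reduced; then [proj_mulr], with [x := mul b c], and
   [projK] reduce the right one. *)
by rewrite mulA mul_proj proj_projl mulA -(mulA a) proj_mulr projK.
Qed.
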